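(* Let $S\subset\mathbb{N}$ be an infinite set of positive integers. Let $\mu$ be a probability measure on $[0,1]$ with continuous density function satisfying $$\mu(I(\mathbf{a}))=\mu(I(\overleftarrow{\mathbf{a}}))$$ for all strings $\mathbf{a}=(a_1,\dots,a_n)$ of positive integers of length $n\in S$. Then $\mu=\mu_{GK}$, i.e., $\mu$ is the measure with density function $f(x)=\frac{1}{\log 2}\,\frac{1}{1+x}$ on $[0,1]$.
   Context: Every $x\in[0,1)$ has a continued fraction expansion $x=[0;a_1(x),a_2(x),\dots]=\cfrac{1}{a_1(x)+\cfrac{1}{a_2(x)+\cdots}}$ with positive integer digits $a_i(x)$; it is infinite and unique for irrational $x$, and finite for rational $x$, where it is made unique by requiring the last digit to be strictly greater than $1$. For a finite string $\mathbf{a}=(a_1,\dots,a_n)$ of positive integers, $I(\mathbf{a})=\{x\in[0,1): a_i(x)=a_i \text{ for } i=1,\dots,n\}$ (the set of $x\in[0,1)$ whose continued fraction expansion begins with $a_1,\dots,a_n$; it is an interval with endpoints $[0;a_1,\dots,a_n]$ and $[0;a_1,\dots,a_{n-1},a_n+1]$). The reverse of $\mathbf{a}$ is $\overleftarrow{\mathbf{a}}=(a_n,\dots,a_1)$. The Gauss--Kuzmin measure is the measure $\mu_{GK}$ on $[0,1]$ given by $\mu_{GK}(I)=\frac{1}{\log 2}\int_I\frac{dx}{1+x}$. *)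

(* Defs.v *)
From HB Require Import structures.
From mathcomp Require Import all_boot all_order all_algebra.
From mathcomp Require Import all_classical all_reals all_analysis.

Set Implicit Arguments.
Unset Strict Implicit.
Unset Printing Implicit Defensive.

Import Order.TTheory GRing.Theory Num.Theory.
Import numFieldNormedType.Exports.

Local Open Scope classical_set_scope.
Local Open Scope ring_scope.

(* [0; a_1, ..., a_n], with value 0 on the empty string. *)
Fixpoint cf_value (R : realType) (a : seq nat) : R :=
  if a is d :: a' then (d%:R + cf_value R a')^-1 else 0.

Definition pos_digits (a : seq nat) : bool := all (leq 1) a.

(* The default 2 makes the last-digit condition void on the empty string,
   which is the expansion of 0. *)
Definition finite_cf (R : realType) (x : R) (a : seq nat) : Prop :=
  [/\ pos_digits a, (1 < last 2 a)%N & x = cf_value R a].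

(* [u n] is the digit a_{n+1}; an infinite continued fraction is the limit of
   its convergents. *)
Definition infinite_cf (R : realType) (x : R) (u : nat -> nat) : Prop :=
  (forall n, (0 < u n)%N) /\ cf_value R (mkseq u n) @[n --> \oo] --> x.

Definition cf_begins (R : realType) (x : R) (a : seq nat) : Prop :=
  (exists s, finite_cf x s /\ prefix a s) \/
  (exists u, infinite_cf x u /\ mkseq u (size a) = a).

(* The set I(a). *)
Definition cylinder (R : realType) (a : seq nat) : set R :=
  [set x | 0 <= x < 1 /\ cf_begins x a].

Arguments cylinder R a : clear implicits.

(* A measure on [0, 1] is represented by a Borel measure on the real line
   carried by [0, 1]: its density is integrated over A `&` `[0, 1] only. *)
Definition has_continuous_density (R : realType)
    (mu : set (measurableTypeR R) -> \bar R) : Prop :=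
  exists f : R -> R,
    [/\ {within `[0, 1], continuous f},
        (forall x, x \in `[0, 1] -> 0 <= f x) &
        (forall A : set (measurableTypeR R), measurable A ->
          mu A = \int[@lebesgue_measure R]_(x in A `&` `[0%R, 1%R]) (f x)%:E)%E].

Definition gauss_kuzmin (R : realType) (A : set (measurableTypeR R)) : \bar R :=
  (((ln 2)^-1)%:E *
   \int[@lebesgue_measure R]_(x in A `&` `[0%R, 1%R]) ((1 + x)^-1)%:E)%E.

(* Main.v *)
(* Write K(a) for the product of the symmetric matrices [[0, 1], [1, d]] over
   the digits d of a, with entries [[p', p], [q', q]].  Then p / q = [0; a], and
   K(rev a) is the transpose of K(a), so q' / q = [0; rev a].  As det K(a) = +-1,
   the intervals I(a) and I(rev a) have lengths 1 / (q (q + q')) and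
   1 / (q (q + p)).  If a starts with digits that force I(a) close to x, and
   ends with the reverse of digits that force I(rev a) close to y, the hypothesis
   mu(I(a)) = mu(I(rev a)) for a density f gives
   f(x) / (1 + y) ~ f(y) / (1 + x).  Since the length of a can be taken in the
   infinite set S and arbitrarily large, (1 + x) f(x) is constant. *)

Require Import Defs.
From HB Require Import structures.
From mathcomp Require Import all_boot all_order all_algebra.
From mathcomp Require Import all_classical all_reals all_analysis.
From mathcomp Require Import ring lra.

Set Implicit Arguments.
Unset Strict Implicit.
Unset Printing Implicit Defensive.

Import Order.TTheory GRing.Theory Num.Theory.
Import numFieldNormedType.Exports.

Local Open Scope classical_set_scope.
Local Open Scope ring_scope.

(** * Digit strings as Moebius maps *)

(* The Moebius map t |-> [0; a_1, ..., a_n + t]. *)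
Fixpoint cf_map (R : realType) (a : seq nat) (t : R) : R :=
  if a is d :: a' then (d%:R + cf_map a' t)^-1 else t.

Lemma cf_value_cat (R : realType) (a b : seq nat) :
  cf_value R (a ++ b) = cf_map a (cf_value R b).
Proof. by elim: a => //= d a ->. Qed.

Lemma cf_map_cat (R : realType) (a b : seq nat) (t : R) :
  cf_map (a ++ b) t = cf_map a (cf_map b t).
Proof. by elim: a => //= d a ->. Qed.

Lemma cf_value_map (R : realType) (a : seq nat) : cf_value R a = cf_map a 0.
Proof. by elim: a => //= d a ->. Qed.

Lemma cf_map_itv (R : realType) (a : seq nat) (t : R) : pos_digits a ->
  0 <= t <= 1 -> 0 <= cf_map a t <= 1.
Proof.
elim: a => //= d a IHa /andP[d_gt0 a_pos] t01.
have /andP[m0 m1] := IHa a_pos t01.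
have d1 : 1 <= d%:R :> R by rewrite ler1n.
have dm1 : 1 <= d%:R + cf_map a t by lra.
by rewrite invr_ge0 invf_le1; lra.
Qed.

(** The difference of [(d + x)^-1] and [(d + y)^-1] is, up to sign, [x - y] divided by
    [(d + x) * (d + y)], which is at least 1, so no digit expands distances. *)
Lemma cf_map_lipschitz (R : realType) (a : seq nat) (s t : R) : pos_digits a ->
  0 <= s <= 1 -> 0 <= t <= 1 -> `|cf_map a s - cf_map a t| <= `|s - t|.
Proof.
elim: a => //= d a IHa /andP[d_gt0 a_pos] s01 t01.
have /andP[s0 _] := cf_map_itv a_pos s01.
have /andP[t0 _] := cf_map_itv a_pos t01.
apply: le_trans (IHa a_pos s01 t01).
have d1 : 1 <= d%:R :> R by rewrite ler1n.
set x := cf_map a s in s0 *; set y := cf_map a t in t0 *.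
have -> : (d%:R + x)^-1 - (d%:R + y)^-1
    = - ((x - y) / ((d%:R + x) * (d%:R + y))).
  by field; apply/andP; split; apply: lt0r_neq0; lra.
have xy1 : 1 <= (d%:R + x) * (d%:R + y) by nra.
rewrite normrN normrM ler_piMr// ger0_norm ?invr_ge0 ?invf_le1; lra.
Qed.

(** * Matrices of digit strings and lengths of image intervals *)

Definition digit_mx (R : realType) (d : nat) : 'M[R]_2 :=
  \matrix_(i, j) if (i == 1) && (j == 1) then d%:R else (i != j)%:R.

Fixpoint cf_mx (R : realType) (a : seq nat) : 'M[R]_2 :=
  if a is d :: a' then digit_mx R d *m cf_mx R a' else 1%:M.

Lemma cf_mx_rcons (R : realType) (a : seq nat) (d : nat) :
  cf_mx R (rcons a d) = cf_mx R a *m digit_mx R d.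
Proof. by elim: a => /= [|e a ->]; rewrite ?mulmx1 ?mul1mx ?mulmxA. Qed.

(* Digit matrices are symmetric, so reversing a string transposes its
   matrix. *)
Lemma cf_mx_rev (R : realType) (a : seq nat) : cf_mx R (rev a) = (cf_mx R a)^T.
Proof.
elim: a => [|d a IHa]; first by rewrite /rev/= trmx1.
rewrite rev_cons cf_mx_rcons /= trmx_mul IHa; congr (_ *m _).
by apply/matrixP => i j; rewrite !mxE andbC [i == j]eq_sym.
Qed.

Lemma cf_mx_cons0 (R : realType) (d : nat) (a : seq nat) (j : 'I_2) :
  cf_mx R (d :: a) 0 j = cf_mx R a 1 j.
Proof.
rewrite /= mxE !big_ord_recl big_ord0 !mxE /= mul0r mul1r add0r addr0.
by congr (cf_mx R a _ j); apply/val_inj.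
Qed.

Lemma cf_mx_cons1 (R : realType) (d : nat) (a : seq nat) (j : 'I_2) :
  cf_mx R (d :: a) 1 j = cf_mx R a 0 j + d%:R * cf_mx R a 1 j.
Proof.
rewrite /= mxE !big_ord_recl big_ord0 !mxE /= mul1r addr0.
by congr (_ + _ * cf_mx R a _ j); apply/val_inj.
Qed.

Lemma cf_mx_ge0 (R : realType) (a : seq nat) (i j : 'I_2) : 0 <= cf_mx R a i j.
Proof.
suff : forall j, 0 <= cf_mx R a 0 j /\ 0 <= cf_mx R a 1 j.
  move=> /(_ j)[]; case: i => [[|[|//]] lti] *.
    by have -> : Ordinal lti = 0 by apply/val_inj.
  by have -> : Ordinal lti = 1 by apply/val_inj.
move=> {}j; elim: a => [|d a [IH0 IH1]]; first by rewrite !mxE !ler0n.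
by rewrite cf_mx_cons0 cf_mx_cons1; split => //; rewrite addr_ge0// mulr_ge0.
Qed.

Lemma cf_mx11_ge1 (R : realType) (a : seq nat) : pos_digits a ->
  1 <= cf_mx R a 1 1.
Proof.
elim: a => [|d a IHa] /=; first by rewrite mxE eqxx.
move=> /andP[d_gt0 /IHa q1]; rewrite -/(cf_mx R (d :: a)) cf_mx_cons1.
have d1 : 1 <= d%:R :> R by rewrite ler1n.
by have := cf_mx_ge0 R a 0 1; nra.
Qed.

(** This linear growth of denominators makes the intervals of long strings short. *)
Lemma cf_mx_row1_ge (R : realType) (a : seq nat) : pos_digits a ->
  (size a).+1%:R <= cf_mx R a 1 1 + cf_mx R a 1 0.
Proof.
(* The top row joins the induction: a new digit [d] adds the top sum, at least 1, to [d] times the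
   bottom sum. *)
suff : pos_digits a -> 1 <= cf_mx R a 0 1 + cf_mx R a 0 0 /\
    (size a).+1%:R <= cf_mx R a 1 1 + cf_mx R a 1 0 by move=> H /H[].
elim: a => [|d a IHa]; first by rewrite !mxE /= addr0 add0r.
move=> /= /andP[d_gt0 /IHa[p1 q1]].
rewrite -/(cf_mx R (d :: a)) !cf_mx_cons1 !cf_mx_cons0.
have d1 : 1 <= d%:R :> R by rewrite ler1n.
have n1 : 1 <= (size a).+1%:R :> R by rewrite ler1n.
rewrite [(size a).+2%:R]mulrS; split; first lra.
set q := cf_mx R a 1 1 + cf_mx R a 1 0 in q1.
have : q <= d%:R * q by rewrite ler_peMl//; lra.
by rewrite /q in q1 *; rewrite mulrDr; lra.
Qed.

Lemma cf_mx_det (R : realType) (a : seq nat) :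
  cf_mx R a 0 0 * cf_mx R a 1 1 - cf_mx R a 0 1 * cf_mx R a 1 0
    = (-1) ^+ size a.
Proof.
elim: a => [|d a IHa]; first by rewrite !mxE /= mulr1 mul0r subr0.
rewrite !cf_mx_cons0 !cf_mx_cons1 /= exprS -IHa; ring.
Qed.

(** The rows are [p', p] and [q', q], so column 0 carries the coefficients of [t] and column 1 the
    constant terms. *)
Lemma cf_mapE (R : realType) (a : seq nat) (t : R) : pos_digits a ->
  0 <= t -> cf_map a t = (cf_mx R a 0 1 + cf_mx R a 0 0 * t) /
                         (cf_mx R a 1 1 + cf_mx R a 1 0 * t).
Proof.
move=> + t0; elim: a => [|d a IHa].
  by rewrite !mxE /= mul1r mul0r addr0 add0r divr1.
move=> da_pos; have /= /andP[d_gt0 a_pos] := da_pos.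
have := cf_mx11_ge1 R da_pos; have := cf_mx_ge0 R (d :: a) 1 0.
rewrite -/(cf_mx R (d :: a)) !cf_mx_cons0 !cf_mx_cons1 IHa// => ? ?.
have q1 := cf_mx11_ge1 R a_pos; have q0 := cf_mx_ge0 R a 1 0.
have p1 := cf_mx_ge0 R a 0 1; have p0 := cf_mx_ge0 R a 0 0.
by field; apply/andP; split; apply: lt0r_neq0; nra.
Qed.

(** The numerator of the difference of the two fractions is the determinant, which is 1 or -1. *)
Lemma cf_map_length (R : realType) (a : seq nat) : pos_digits a ->
  `|cf_map a 1 - cf_map a 0 : R| =
    (cf_mx R a 1 1 * (cf_mx R a 1 1 + cf_mx R a 1 0))^-1.
Proof.
move=> a_pos; rewrite !cf_mapE// !mulr0 !mulr1 !addr0.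
have q1 := cf_mx11_ge1 R a_pos; have q0 := cf_mx_ge0 R a 1 0.
have -> : (cf_mx R a 0 1 + cf_mx R a 0 0) / (cf_mx R a 1 1 + cf_mx R a 1 0)
    - cf_mx R a 0 1 / cf_mx R a 1 1 =
  (cf_mx R a 0 0 * cf_mx R a 1 1 - cf_mx R a 0 1 * cf_mx R a 1 0) /
  (cf_mx R a 1 1 * (cf_mx R a 1 1 + cf_mx R a 1 0)).
  by field; apply/andP; split; apply: lt0r_neq0; lra.
rewrite cf_mx_det normrM normrX normrN1 expr1n mul1r ger0_norm//.
by rewrite invr_ge0; nra.
Qed.

Lemma cf_map_length_le (R : realType) (a : seq nat) : pos_digits a ->
  `|cf_map a 1 - cf_map a 0 : R| <= (size a).+1%:R^-1.
Proof.
move=> a_pos; rewrite cf_map_length//.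
have q1 := cf_mx11_ge1 R a_pos; have := cf_mx_row1_ge R a_pos.
have n1 : 0 < (size a).+1%:R :> R by rewrite ltr0n.
by move=> ?; rewrite lef_pV2 ?posrE//; nra.
Qed.

(** * Cells: the intervals spanned by the images of 0 and 1 *)

(** For nonempty [a] the endpoints are [[0; a_1, ..., a_n]] and [[0; a_1, ..., a_n + 1]]; the parity
    of [n] decides which is smaller. *)
Definition cell_min (R : realType) (a : seq nat) : R :=
  Num.min (cf_map a 0) (cf_map a 1).
Definition cell_max (R : realType) (a : seq nat) : R :=
  Num.max (cf_map a 0) (cf_map a 1).

(** Each map [t |-> (d + t)^-1] reverses the order, so every digit exchanges the roles of the two
    endpoints. *)
Lemma cf_map_cell (R : realType) (a : seq nat) (t : R) : pos_digits a ->
  0 <= t <= 1 -> cell_min R a <= cf_map a t <= cell_max R a.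
Proof.
rewrite /cell_min /cell_max.
elim: a => [|d a IHa] /=.
  by move=> _ t01; rewrite min_l ?max_r ?ler01.
move=> /andP[d_gt0 a_pos] t01.
have z01 : 0 <= (0 : R) <= 1 by rewrite lexx ler01.
have o01 : 0 <= (1 : R) <= 1 by rewrite lexx ler01.
have /andP[m0 _] := cf_map_itv a_pos z01.
have /andP[m1 _] := cf_map_itv a_pos o01.
have /andP[mt _] := cf_map_itv a_pos t01.
have d1 : 1 <= d%:R :> R by rewrite ler1n.
have := IHa a_pos t01.
rewrite !ge_min !le_max !lef_pV2 ?posrE; lra.
Qed.

(** Peel off the first digit: [x^-1 - d] lies in the open cell of the remaining string. *)
Lemma cell_inv (R : realType) (a : seq nat) (x : R) : pos_digits a ->
  cell_min R a < x < cell_max R a -> exists2 t, 0 < t < 1 & x = cf_map a t.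
Proof.
rewrite /cell_min /cell_max.
elim: a x => [|d a IHa] x /=.
  by rewrite min_l ?max_r ?ler01// => _ x01; exists x.
move=> /andP[d_gt0 a_pos] x01.
have z01 : 0 <= (0 : R) <= 1 by rewrite lexx ler01.
have o01 : 0 <= (1 : R) <= 1 by rewrite lexx ler01.
have /andP[m0 _] := cf_map_itv a_pos z01.
have /andP[m1 _] := cf_map_itv a_pos o01.
have d1 : 1 <= d%:R :> R by rewrite ler1n.
have x0 : 0 < x.
  move: x01 => /andP[+ _]; apply: le_lt_trans.
  by rewrite le_min !invr_ge0; lra.
have [|t t01 xt] := IHa (x^-1 - d%:R) a_pos; last first.
  by exists t => //; rewrite -xt addrC subrK invrK.
move: x01; rewrite !gt_min !lt_max !ltrBrDl !ltrBlDl.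
rewrite -![_ < x^-1](ltf_pV2) ?posrE ?invr_gt0 ?invrK//; try lra.
rewrite -![x^-1 < _](ltf_pV2) ?posrE ?invr_gt0 ?invrK//; lra.
Qed.

Lemma cf_map_dist (R : realType) (a : seq nat) (s t : R) : pos_digits a ->
  0 <= s <= 1 -> 0 <= t <= 1 ->
  `|cf_map a s - cf_map a t| <= (size a).+1%:R^-1.
Proof.
move=> a_pos s01 t01; apply: le_trans (cf_map_length_le R a_pos).
have := cf_map_cell a_pos s01; have := cf_map_cell a_pos t01.
rewrite /cell_min /cell_max ler_distl.
by case: (lerP (cf_map a 0) (cf_map a 1)) => ?; lra.
Qed.

(** * Existence of expansions through the Gauss map *)

Lemma mkseq_cat (T : Type) (f : nat -> T) (m n : nat) :
  mkseq f (m + n) = mkseq f m ++ mkseq (fun i => f (m + i)%N) n.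
Proof.
rewrite /mkseq iotaD map_cat add0n -[X in iota X n]addn0 iotaDl -map_comp.
by congr (_ ++ _).
Qed.

Lemma pos_digits_mkseq (u : nat -> nat) (n : nat) : (forall i, (0 < u i)%N) ->
  pos_digits (mkseq u n).
Proof. by move=> u_pos; apply/allP => d /mapP[i _ ->]. Qed.

Lemma cf_value_itv (R : realType) (a : seq nat) : pos_digits a ->
  0 <= cf_value R a <= 1.
Proof. by move=> a_pos; rewrite cf_value_map cf_map_itv// lexx ler01. Qed.

(** With [0^-1 = 0], the point [0] is fixed, so an orbit that reaches [0] stays there. *)
Definition gauss_map (R : realType) (x : R) : R := x^-1 - (Num.truncn x^-1)%:R.

Lemma gauss_map_itv (R : realType) (x : R) : 0 <= x -> 0 <= gauss_map x < 1.
Proof.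
move=> x0; have : 0 <= x^-1 by rewrite invr_ge0.
move=> /truncn_itv; rewrite /gauss_map; set k := Num.truncn _.
by rewrite -[k.+1]addn1 natrD; lra.
Qed.

Lemma gauss_map_iter_itv (R : realType) (x : R) (n : nat) : 0 <= x < 1 ->
  0 <= iter n (@gauss_map R) x < 1.
Proof.
move=> x01; elim: n => //= n /andP[x0 _]; exact: gauss_map_itv.
Qed.

Definition gauss_digit (R : realType) (x : R) (n : nat) : nat :=
  Num.truncn (iter n (@gauss_map R) x)^-1.

Lemma gauss_digit_gt0 (R : realType) (x : R) (n : nat) : 0 <= x < 1 ->
  iter n (@gauss_map R) x != 0 -> (0 < gauss_digit x n)%N.
Proof.
move=> x01 xn0; have := gauss_map_iter_itv n x01.
rewrite le_eqVlt eq_sym (negPf xn0) /= => /andP[xn_gt0 xn1].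
by rewrite truncn_gt0 invf_ge1// ltW.
Qed.

(** Digit plus remainder is exactly the inverse of the current point, and inversion is an involution
    even at [0]; hence no condition on [x]. *)
Lemma gauss_expansion (R : realType) (x : R) (n : nat) :
  cf_map (mkseq (gauss_digit x) n) (iter n (@gauss_map R) x) = x.
Proof.
elim: n => [//|n IHn]; rewrite mkseqS -cats1 cf_map_cat/=.
by rewrite /gauss_map /gauss_digit addrC subrK invrK.
Qed.

Lemma cf_expansion (R : realType) (x : R) : 0 <= x < 1 ->
  (exists s, finite_cf x s) \/ (exists u, infinite_cf x u).
Proof.
move=> x01.
have [[n xn]|orbit_neq0] := pselect (exists n, iter n (@gauss_map R) x == 0).
  left; have xE : exists n, iter n (@gauss_map R) x == 0 by exists n.
  (* The first time the orbit hits [0] is the number of digits; time 0 means [x = 0] and the empty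
     string. *)
  case: (ex_minnP xE) => {n xE xn} -[|n] /eqP xn n_min.
    by exists [::]; split => //; rewrite -xn.
  exists (mkseq (gauss_digit x) n.+1).
  have nz i : (i <= n)%N -> iter i (@gauss_map R) x != 0.
    by rewrite leqNgt; apply: contra => /n_min.
  split; last by rewrite cf_value_map -{1}(gauss_expansion x n.+1) xn.
    apply/allP => d /mapP[i]; rewrite mem_iota add0n ltnS => /= /nz xi ->.
    exact: gauss_digit_gt0.
  (* The last digit is the inverse of the last nonzero orbit point; that point is below 1, so the
     digit exceeds 1. *)
  rewrite mkseqS last_rcons -(ltr_nat R).
  have -> : (gauss_digit x n)%:R = (iter n (@gauss_map R) x)^-1.
    by move: xn => /=; rewrite {1}/gauss_map => /eqP; rewrite subr_eq0 => /eqP.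
  have /andP[xn0 xn1] := gauss_map_iter_itv n x01.
  by rewrite invf_gt1// lt_def nz.
right; exists (gauss_digit x).
have u_pos n : (0 < gauss_digit x n)%N.
  by apply: gauss_digit_gt0 => //; apply/negP => xn; apply: orbit_neq0; exists n.
split=> //; apply/cvgrPdist_le => e e0.
(* [x] and its convergent are images under the same map, of the remainder and of [0], so they differ
   by at most [1 / (n + 1)]. *)
near=> n; rewrite -{1}(gauss_expansion x n) cf_value_map.
have xn01 := gauss_map_iter_itv n x01.
apply: le_trans (cf_map_dist _ _ _) _; rewrite ?pos_digits_mkseq//; try lra.
rewrite size_mkseq ltW//; near: n.
exact: (near_infty_natSinv_lt (PosNum e0)).
Unshelve. all: by end_near. Qed.

(** * Cylinders and cells agree up to endpoints *)

Lemma cylinder_sub_cell (R : realType) (a : seq nat) : pos_digits a ->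
  cylinder R a `<=` `[cell_min R a, cell_max R a].
Proof.
move=> a_pos x [_ [[s [[s_pos _ ->] /prefixP[b sE]]]|[u [[u_pos ux] ua]]]].
  move: s_pos; rewrite sE /pos_digits all_cat => /andP[_ b_pos].
  by rewrite /= in_itv/= cf_value_cat cf_map_cell// cf_value_itv.
(* All convergents of length at least [size a] lie in the cell, which is closed. *)
apply: (closed_cvg _ (@itv_closed _ _ _ _) _ _ ux).
exists (size a) => // n /= /subnKC <-; rewrite mkseq_cat ua cf_value_cat.
by rewrite in_itv/= cf_map_cell// cf_value_itv// pos_digits_mkseq.
Qed.

(** A point of the open cell is the image of some [t] strictly between 0 and 1; prepending [a] to an
    expansion of [t] expands the point. *)
Lemma cell_sub_cylinder (R : realType) (a : seq nat) : pos_digits a ->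
  `]cell_min R a, cell_max R a[ `<=` cylinder R a.
Proof.
move=> a_pos x /=; rewrite in_itv/= => x_cell.
have z01 : 0 <= (0 : R) <= 1 by rewrite lexx ler01.
have o01 : 0 <= (1 : R) <= 1 by rewrite lexx ler01.
split.
  move: x_cell; rewrite /cell_min /cell_max.
  have := cf_map_itv a_pos z01; have := cf_map_itv a_pos o01.
  by case: (lerP (cf_map a 0) (cf_map a 1)); lra.
have [t t01 ->] := cell_inv a_pos x_cell.
have t01' : 0 <= t < 1 by lra.
have [[s [s_pos s1 tE]]|[u [u_pos ut]]] := cf_expansion t01'.
  left; exists (a ++ s); rewrite prefix_prefix; split=> //; split.
  - by rewrite /pos_digits all_cat; apply/andP.
  (* As [t > 0], the string [s] is nonempty, so [a ++ s] inherits its last digit and the condition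
     on it. *)
  - case: s tE s1 {s_pos} => [t0|d s _]; last by rewrite last_cat.
    by move: t01; rewrite t0 ltxx.
  - by rewrite cf_value_cat tE.
right; exists (fun i => if (i < size a)%N then nth 0%N a i else u (i - size a)%N).
set v := fun i => _.
have va : mkseq v (size a) = a.
  rewrite -[RHS](mkseq_nth 0%N); apply/eq_in_map => i.
  by rewrite mem_iota /v add0n => /= ->.
split=> //; split.
  move=> i; rewrite /v; case: ifPn => // ia.
  by move/allP : a_pos; apply; rewrite mem_nth.
(* After a shift by [size a], the convergents are images under [cf_map a] of those of [t], and the
   Lipschitz bound carries the limit over. *)
rewrite -(cvg_shiftn (size a)); apply/cvgrPdist_le => e e0.
near=> n; rewrite /= addnC mkseq_cat va cf_value_cat.
rewrite (_ : mkseq _ n = mkseq u n); last first.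
  by apply: eq_mkseq => i; rewrite /v ltnNge leq_addr /= addKn.
apply: le_trans (cf_map_lipschitz _ _ _) _;
  rewrite ?cf_value_itv ?pos_digits_mkseq//.
  by lra.
near: n; by move/cvgrPdist_le : ut; apply.
Unshelve. all: by end_near. Qed.

(** * Approximation of points by small cells *)

(** An infinite expansion is cut off late; a finite one is continued by one huge digit. *)
Lemma cell_approx (R : realType) (x e : R) : 0 <= x <= 1 -> 0 < e ->
  exists2 b, pos_digits b &
    forall t, 0 <= t <= 1 -> `|cf_map b t - x| < e.
Proof.
move=> x01 e0.
suff finite_case s : pos_digits s -> x = cf_value R s -> exists2 b, pos_digits b &
    forall t, 0 <= t <= 1 -> `|cf_map b t - x| < e.
  move: x01; rewrite le_eqVlt [x <= 1]le_eqVlt => /andP[x0 /orP[/eqP x1|x1]].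
    (* Expansions are available on [[0, 1)] only; the endpoint 1 is [[0; 1]], whose last digit 1 is
       allowed in [finite_case]. *)
    by apply: (finite_case [:: 1%N]) => //; rewrite /= addr0 invr1.
  have x01 : 0 <= x < 1 by rewrite le_eqVlt x0.
  have [[s [s_pos _ xs]]|[u [u_pos ux]]] := cf_expansion x01.
    exact: finite_case xs.
  have e20 : 0 < e / 2 by rewrite divr_gt0.
  near \oo => n; exists (mkseq u n) => [|t t01]; first exact: pos_digits_mkseq.
  have z01 : 0 <= (0 : R) <= 1 by rewrite lexx ler01.
  have -> : e = e / 2 + e / 2 by field.
  (* Triangle inequality through the convergent: half of [e] for the cell length, half for the
     convergence. *)
  rewrite -(subrK (cf_value R (mkseq u n)) (cf_map _ t)) -addrA.
  apply: le_lt_trans (ler_normD _ _) _.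
  apply: ltr_leD; last first.
    rewrite distrC; near: n; move/cvgrPdist_le : ux; apply; by rewrite divr_gt0.
  rewrite cf_value_map; apply: le_lt_trans (cf_map_dist _ _ _) _ => //.
    exact: pos_digits_mkseq.
  rewrite size_mkseq; near: n; exact: (near_infty_natSinv_lt (PosNum e20)).
(* The extra digit [n + 1] brings the argument of [cf_map s] within [1 / (n + 1)] of 0. *)
move=> s_pos ->; near \oo => n.
exists (s ++ [:: n.+1]) => [|t t01]; first by rewrite /pos_digits all_cat andbT.
rewrite cf_map_cat cf_value_map.
have n1 : 1 <= n.+1%:R :> R by rewrite ler1n.
have nt0 : 0 < n.+1%:R + t by lra.
apply: le_lt_trans (cf_map_lipschitz _ _ _) _ => //=.
- by rewrite invr_ge0 invf_le1//; lra.
- by rewrite lexx ler01.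
rewrite subr0 ger0_norm ?invr_ge0; last by lra.
apply: (@le_lt_trans _ _ n.+1%:R^-1); first by rewrite lef_pV2 ?posrE; lra.
near: n; exact: (near_infty_natSinv_lt (PosNum e0)).
Unshelve. all: by end_near. Qed.

(** * Length of cells and measurability of cylinders *)

Lemma cell_length (R : realType) (a : seq nat) : pos_digits a ->
  cell_max R a - cell_min R a =
    (cf_mx R a 1 1 * (cf_mx R a 1 1 + cf_mx R a 1 0))^-1.
Proof.
move=> a_pos; rewrite -cf_map_length// /cell_max /cell_min.
by case: (lerP (cf_map a 0) (cf_map a 1)).
Qed.

Lemma cell_min_lt_max (R : realType) (a : seq nat) : pos_digits a ->
  cell_min R a < cell_max R a.
Proof.
move=> a_pos; rewrite -subr_gt0 cell_length// invr_gt0.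
by have := cf_mx11_ge1 R a_pos; have := cf_mx_ge0 R a 1 0; nra.
Qed.

Lemma cell_sub_itv (R : realType) (a : seq nat) : pos_digits a ->
  `[cell_min R a, cell_max R a] `<=` `[0, 1].
Proof.
move=> a_pos x; rewrite /= !in_itv /cell_min /cell_max /=.
have z01 : 0 <= (0 : R) <= 1 by rewrite lexx ler01.
have o01 : 0 <= (1 : R) <= 1 by rewrite lexx ler01.
have := cf_map_itv a_pos z01; have := cf_map_itv a_pos o01.
by case: (lerP (cf_map a 0) (cf_map a 1)); lra.
Qed.

(** The cylinder is the open cell plus at most two endpoints, so it need not be decided which
    endpoints belong to it. *)
Lemma measurable_cylinder (R : realType) (a : seq nat) : pos_digits a ->
  measurable (cylinder R a : set (measurableTypeR R)).
Proof.
move=> a_pos.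
have -> : cylinder R a = `]cell_min R a, cell_max R a[ `|`
    (cylinder R a `&` [set cell_min R a; cell_max R a]).
  apply/seteqP; split=> [x xa|x [|[]//]]; last exact: cell_sub_cylinder.
  have := cylinder_sub_cell a_pos xa; rewrite /= !in_itv/= !le_eqVlt.
  case/andP => /orP[/eqP xm|xm]; first by right; split=> //; left.
  by case/orP => [/eqP xM|xM]; [right; split=> //; right|left; rewrite xm xM].
apply: measurableU; first exact: measurable_itv.
apply: countable_measurable; first exact: measurable_set1.
apply: finite_set_countable.
apply: (@sub_finite_set _ _ [set cell_min R a; cell_max R a]).
  exact: subIsetr.
exact: finite_set2.
Qed.

(** * Measure of cylinders under a continuous density *)

Lemma within_continuous_dist (R : realType) (A : set R) (f : R -> R) (x e : R) :
  {within A, continuous f} -> A x -> 0 < e ->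
  exists2 d, 0 < d & forall t, A t -> `|t - x| < d -> `|f t - f x| < e.
Proof.
move=> /subspace_continuousP cf Ax e0.
have /cvgrPdist_lt/(_ _ e0) := cf x Ax.
rewrite near_withinE => /nbhs_ballP[d d0 xd]; exists d => // t At tx.
by rewrite distrC; apply: xd => //=; rewrite /ball/= distrC.
Qed.

Lemma integral_itv_bounds (R : realType) (f : R -> R) (u v lo hi : R)
    (b0 b1 : bool) : u < v ->
  {within `[u, v], continuous f} ->
  (forall x, x \in `[u, v] -> lo <= f x <= hi) ->
  ((lo * (v - u))%:E <=
   \int[@lebesgue_measure R]_(x in [set` Interval (BSide b0 u) (BSide b1 v)])
     (f x)%:E
   <= (hi * (v - u))%:E)%E.
Proof.
move=> uv cf f_bound; set D := [set` _].
have mD : measurable D by exact: measurable_itv.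
have DS : D `<=` `[u, v] by apply: subset_itvScc; rewrite ?bnd_simp.
have fD : (@lebesgue_measure R).-integrable D (EFin \o f).
  apply: (@integrableS _ (measurableTypeR R) R _ (`[u, v])) => //.
  by apply: continuous_compact_integrable => //; exact: segment_compact.
have cstD (c : R) : (@lebesgue_measure R).-integrable D (EFin \o cst c).
  apply: (@integrableS _ (measurableTypeR R) R _ (`[u, v])) => //.
  apply: continuous_compact_integrable; first exact: segment_compact.
  by move=> ?; apply: cst_continuous.
have int_cst (c : R) : (\int[@lebesgue_measure R]_(x in D) (cst c x)%:E
    = (c * (v - u))%:E)%E.
  transitivity (c%:E * @lebesgue_measure R D)%E.
    exact: (@integral_cst _ (measurableTypeR R) R _ _ mD c%:E).
  by rewrite /D lebesgue_measure_itv/= lte_fin uv.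
rewrite -!int_cst; apply/andP; split.
- apply: (@le_integral _ (measurableTypeR R) R (@lebesgue_measure R) D mD
    (EFin \o cst lo) (EFin \o f) (cstD lo) fD) => x /set_mem /DS xuv.
  by rewrite lee_fin; have /andP[] := f_bound _ xuv.
- apply: (@le_integral _ (measurableTypeR R) R (@lebesgue_measure R) D mD
    (EFin \o f) (EFin \o cst hi) fD (cstD hi)) => x /set_mem /DS xuv.
  by rewrite lee_fin; have /andP[] := f_bound _ xuv.
Qed.

(** The cylinder is squeezed between the open and the closed cell, whose integrals obey the same
    bounds. *)
Lemma cylinder_measure_bounds (R : realType)
    (mu : {measure set (measurableTypeR R) -> \bar R}) (f : R -> R)
    (a : seq nat) (lo hi : R) :
  {within `[0, 1], continuous f} ->
  (forall A : set (measurableTypeR R), measurable A ->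
    mu A = \int[@lebesgue_measure R]_(x in A `&` `[0%R, 1%R]) (f x)%:E)%E ->
  pos_digits a ->
  (forall x, x \in `[cell_min R a, cell_max R a] -> lo <= f x <= hi) ->
  ((lo * (cell_max R a - cell_min R a))%:E <= mu (cylinder R a)
   <= (hi * (cell_max R a - cell_min R a))%:E)%E.
Proof.
move=> f_cont muE a_pos f_bound.
have cS := @cell_sub_itv R a a_pos.
have cf : {within `[cell_min R a, cell_max R a], continuous f}.
  exact: continuous_subspaceW f_cont.
have bnd b0 b1 := integral_itv_bounds b0 b1 (cell_min_lt_max R a_pos) cf f_bound.
have mcyl := @measurable_cylinder R a a_pos.
apply/andP; split.
(* The sides [false true] give the open interval; [true false] below gives the closed one. *)
- have /andP[+ _] := bnd false true; move/le_trans; apply.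
  have -> : (\int[@lebesgue_measure R]_(x in `]cell_min R a, cell_max R a[)
      (f x)%:E)%E
      = mu `]cell_min R a, cell_max R a[%classic.
    rewrite muE ?setIidl//; apply: subset_trans cS; exact: subset_itv_oo_cc.
  apply: le_measure; rewrite ?inE//.
  exact: cell_sub_cylinder.
- have /andP[_] := bnd true false; apply: le_trans.
  have -> : (\int[@lebesgue_measure R]_(x in `[cell_min R a, cell_max R a])
      (f x)%:E)%E
      = mu `[cell_min R a, cell_max R a]%classic.
    by rewrite muE ?setIidl.
  apply: le_measure; rewrite ?inE//.
  exact: cylinder_sub_cell.
Qed.

(** * Comparison of the density at two points *)

Lemma infinite_set_unbounded (S : set nat) (N : nat) : infinite_set S ->
  exists2 n, S n & (N <= n)%N.
Proof.
move=> S_inf; apply: contrapT => noS; apply: S_inf.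
apply: (sub_finite_set _ (finite_II N)) => n Sn /=.
by rewrite ltnNge; apply/negP => Nn; apply: noS; exists n.
Qed.

(** The prefix [b] works for every continuation [c], which leaves the rest of the string free for
    padding and for the reversed prefix of the other point. *)
Lemma near_density_bound (R : realType) (f : R -> R) (x e : R) :
  {within `[0, 1], continuous f} -> x \in `[0, 1] -> 0 < e ->
  exists2 b, pos_digits b & forall c, pos_digits c ->
    `|cf_map (b ++ c) 0 - x| < e /\
    forall t, t \in `[cell_min R (b ++ c), cell_max R (b ++ c)] ->
      f x - e <= f t <= f x + e.
Proof.
move=> cf x01 e0; have [d d0 fx] := within_continuous_dist cf x01 e0.
have de0 : 0 < Num.min d e by rewrite lt_min d0.
have x01' : 0 <= x <= 1 by move: x01; rewrite in_itv.
have [b b_pos bx] := cell_approx x01' de0; exists b => // c c_pos.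
have z01 : 0 <= (0 : R) <= 1 by rewrite lexx ler01.
have o01 : 0 <= (1 : R) <= 1 by rewrite lexx ler01.
(* The endpoints of the cell of [b ++ c] are images under [cf_map b] of points of [[0, 1]], hence
   close to [x], and so is all between them. *)
have := bx _ (cf_map_itv c_pos z01); have := bx _ (cf_map_itv c_pos o01).
have bc_pos : pos_digits (b ++ c) by rewrite /pos_digits all_cat; apply/andP.
rewrite -!cf_map_cat !lt_min => /andP[d1 e1] /andP[d2 e2]; split=> // t tcell.
have t01 := cell_sub_itv bc_pos tcell.
rewrite -ler_distl ltW// fx//.
move: tcell d1 d2; rewrite in_itv/= /cell_min /cell_max !ltr_distl.
by case: (lerP (cf_map (b ++ c) 0) (cf_map (b ++ c) 1)) => ?; lra.
Qed.

(** Cross-multiply and divide by [q ^+ 2]: this turns lengths of cells into the factors [1 + [0; a]]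
    and [1 + [0; rev a]]. *)
Lemma ler_inv_length_ratio (F : realFieldType) (u v p q q' : F) : 0 < q ->
  0 <= p -> 0 <= q' ->
  u * (q * (q + q'))^-1 <= v * (q * (q + p))^-1 ->
  u * (1 + p / q) <= v * (1 + q' / q).
Proof.
move=> q0 p0 q'0; have qn0 : q != 0 by rewrite lt0r_neq0.
have qp0 : 0 < q * (q + p) by rewrite mulr_gt0// ltr_wpDr.
have qq'0 : 0 < q * (q + q') by rewrite mulr_gt0// ltr_wpDr.
rewrite ler_pdivrMr// mulrAC ler_pdivlMr// => le_uv.
have -> : u * (1 + p / q) = u * (q * (q + p)) / q ^+ 2 by field.
have -> : v * (1 + q' / q) = v * (q * (q + q')) / q ^+ 2 by field.
by rewrite ler_pM2r// invr_gt0 exprn_gt0.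
Qed.

(** One inequality suffices, since [x] and [y] can be exchanged. *)
Lemma reversal_density_le (R : realType) (S : set nat)
    (mu : {measure set (measurableTypeR R) -> \bar R}) (f : R -> R) (x y : R) :
  infinite_set S ->
  {within `[0, 1], continuous f} ->
  (forall x, x \in `[0, 1] -> 0 <= f x) ->
  (forall A : set (measurableTypeR R), measurable A ->
    mu A = \int[@lebesgue_measure R]_(x in A `&` `[0%R, 1%R]) (f x)%:E)%E ->
  (forall a : seq nat, pos_digits a -> S (size a) ->
    mu (cylinder R a) = mu (cylinder R (rev a))) ->
  x \in `[0, 1] -> y \in `[0, 1] ->
  f x * (1 + x) <= f y * (1 + y).
Proof.
move=> S_inf f_cont f_ge0 muE mu_rev x01 y01.
have fx0 := f_ge0 _ x01; have fy0 := f_ge0 _ y01.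
apply/ler_addgt0Pr => eta eta0.
have den0 : 0 < f x + f y + 4 by lra.
(* Replacing [p / q] by [x] and [q' / q] by [y] costs at most [e * f x] and [e * f y]; the errors in
   the density cost at most [2 * e] on each side. *)
pose e := eta / (f x + f y + 4).
have e0 : 0 < e by rewrite divr_gt0.
have [b b_pos bx] := near_density_bound f_cont x01 e0.
have [c c_pos cy] := near_density_bound f_cont y01 e0.
have [n Sn bc_n] := infinite_set_unbounded (size b + size c) S_inf.
(* Padding by digits 1 brings the length to [n], an element of [S], while [a] still begins with [b]
   and [rev a] with [c]. *)
pose m := nseq (n - (size b + size c)) 1%N.
have m_pos : pos_digits m by rewrite /m /pos_digits all_nseq orbT.
pose a := b ++ m ++ rev c.
have mc_pos : pos_digits (m ++ rev c).
  by rewrite /pos_digits all_cat all_rev; apply/andP.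
have a_pos : pos_digits a by rewrite /pos_digits all_cat; apply/andP.
have size_a : size a = n.
  by rewrite /a !size_cat size_rev size_nseq addnCA addnC subnKC.
have [ax fax] := bx _ mc_pos.
have mb_pos : pos_digits (rev m ++ rev b).
  by rewrite /pos_digits all_cat !all_rev; apply/andP.
have rev_a : rev a = c ++ rev m ++ rev b by rewrite /a !rev_cat revK catA.
have ra_pos : pos_digits (rev a) by rewrite /pos_digits all_rev.
have := cy _ mb_pos; rewrite -rev_a => -[ay fay].
have /andP[mu_lo _] := cylinder_measure_bounds f_cont muE a_pos fax.
have /andP[_ mu_hi] := cylinder_measure_bounds f_cont muE ra_pos fay.
(* Equality of the two measures joins the lower bound near [x] to the upper bound near [y]. *)
have := le_trans mu_lo; rewrite mu_rev ?size_a// => /(_ _ mu_hi).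
rewrite lee_fin !cell_length// cf_mx_rev !mxE.
have z01 : 0 <= (0 : R) <= 1 by rewrite lexx ler01.
move: (cf_map_itv a_pos z01) (cf_map_itv ra_pos z01) ax ay.
rewrite !cf_mapE// cf_mx_rev !mxE !mulr0 !addr0.
have q1 := cf_mx11_ge1 R a_pos; have q0 := cf_mx_ge0 R a 1 0.
have p0 := cf_mx_ge0 R a 0 1.
move: (cf_mx R a 1 1) (cf_mx R a 1 0) (cf_mx R a 0 1) q1 q0 p0.
move=> q q' p q1 q0 p0.
set X := p / q; set Y := q' / q => /andP[X0 X1] /andP[Y0 Y1] xX yY.
move=> cmp; have q_gt0 : 0 < q := lt_le_trans ltr01 q1.
have := ler_inv_length_ratio q_gt0 p0 q0 cmp; rewrite -/X -/Y => {cmp} fxy.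
have -> : eta = e * (f x + f y + 4).
  by rewrite /e divfK ?lt0r_neq0.
move: xX yY; rewrite !ltr_distl => /andP[xX _] /andP[_ yY].
have fxX : f x * (x - X) <= f x * e by apply: ler_wpM2l => //; lra.
have fyY : f y * (Y - y) <= f y * e by apply: ler_wpM2l => //; lra.
have eX : e * X <= e * 1 by apply: ler_wpM2l => //; exact: ltW.
have eY : e * Y <= e * 1 by apply: ler_wpM2l => //; exact: ltW.
lra.
Qed.

(** * Normalization and conclusion *)

Lemma integral_inv1D (R : realType) :
  (\int[@lebesgue_measure R]_(x in `[0%R, 1%R]) ((1 + x)^-1)%:E = (ln 2)%:E)%E.
Proof.
have D1 (x : R) : 0 <= x -> is_derive x 1 (fun t : R => ln (1 + t)) (1 + x)^-1.
  move=> x0; have x10 : 0 < 1 + x by lra.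
  have := @is_derive1_comp R (@ln R) (fun t => 1 + t) x (1 + x)^-1 1
    (is_derive1_ln x10).
  rewrite mulr1; apply.
  by rewrite -[X in is_derive _ _ _ X]add0r; apply: is_deriveD.
have cinv (x : R) : 0 <= x -> {for x, continuous (fun t : R => (1 + t)^-1)}.
  move=> x0; apply: cvgV; first by apply: lt0r_neq0; lra.
  by apply: cvgD; [exact: cvg_cst|exact: cvg_id].
have cln (x : R) : 0 <= x -> {for x, continuous (fun t : R => ln (1 + t))}.
  move=> x0; apply/differentiable_continuous/derivable1_diffP.
  by have [] := D1 x x0.
rewrite (@continuous_FTC2 _ _ (fun t : R => ln (1 + t))) ?ltr01//.
- by rewrite addr0 ln1 sube0.
- apply: continuous_in_subspaceT => x /set_mem /=.
  by rewrite in_itv/= => /andP[x0 _]; exact: cinv.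
- split.
  + move=> x; rewrite in_itv/= => /andP[/ltW x0 _].
    by have [] := D1 x x0.
  + by apply: cvg_at_right_filter; apply: cln.
  + by apply: cvg_at_left_filter; apply: cln.
- move=> x; rewrite in_itv/= => /andP[/ltW x0 _].
  by rewrite derive1E; have [_ ->] := D1 x x0.
Qed.

Theorem theorem1 (R : realType) (S : set nat)
    (S_pos : forall n, S n -> (0 < n)%N)
    (S_infinite : infinite_set S)
    (mu : probability (measurableTypeR R) R)
    (mu_density : has_continuous_density mu)
    (mu_reverse : forall a : seq nat, pos_digits a -> S (size a) ->
       mu (cylinder R a) = mu (cylinder R (rev a))) :
  forall A : set (measurableTypeR R), measurable A -> mu A = gauss_kuzmin A.
Proof.
have [f [f_cont f_ge0 muE]] := mu_density.
(* Comparing [x] with 0 in both directions gives [f x * (1 + x) = f 0]. *)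
have fE x : x \in `[0, 1] -> f x = f 0 * (1 + x)^-1.
  move=> x01; have z01 : (0 : R) \in `[0, 1] by rewrite in_itv/= lexx ler01.
  have := reversal_density_le S_infinite f_cont f_ge0 muE mu_reverse x01 z01.
  have := reversal_density_le S_infinite f_cont f_ge0 muE mu_reverse z01 x01.
  move: x01; rewrite in_itv/= => /andP[x0 _]; rewrite addr0 mulr1 => le1 le2.
  have -> : f 0 = f x * (1 + x) by apply/eqP; rewrite eq_le le1.
  by rewrite mulfK//; apply: lt0r_neq0; lra.
have int_inv : (@lebesgue_measure R).-integrable `[0, 1]
    (fun x : R => ((1 + x)^-1)%:E).
  apply: (@continuous_compact_integrable _ (fun x : R => (1 + x)^-1)).
    exact: segment_compact.
  apply: continuous_in_subspaceT => x /set_mem /=.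
  rewrite in_itv/= => /andP[x0 _]; apply: cvgV; first by apply: lt0r_neq0; lra.
  by apply: cvgD; [exact: cvg_cst|exact: cvg_id].
have muZ A : measurable A -> mu A = ((f 0)%:E *
    \int[@lebesgue_measure R]_(x in A `&` `[0%R, 1%R]) ((1 + x)^-1)%:E)%E.
  move=> mA; rewrite muE//.
  have mA1 : measurable (A `&` `[0%R, 1%R] : set (measurableTypeR R)).
    by apply: measurableI => //; exact: measurable_itv.
  rewrite -(@integralZl _ (measurableTypeR R) R _ _ mA1); last first.
    exact: (@integrableS _ (measurableTypeR R) R _ (`[0, 1])).
  by apply: eq_integral => x /set_mem [_ x01]; rewrite fE// EFinM.
move=> A mA; rewrite muZ// /gauss_kuzmin; congr (_%:E * _)%E.
(* Total mass 1 gives [f 0 * ln 2 = 1], which determines the constant. *)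
have := muZ _ measurableT; rewrite setTI integral_inv1D probability_setT.
have ln2 : 0 < ln (2 : R) by rewrite ln_gt0// ltr1n.
by rewrite -EFinM => -[f0]; rewrite -[LHS](mulfK (lt0r_neq0 ln2)) -f0 mul1r.
Qed.
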